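(* Let $M'$, $M$ be Coxeter matrices over finite sets $I'$, $I$. The following are equivalent for a map $\phi:W(M')\to W(M)$: (a) $\phi$ is both a homomorphism of Coxeter groups $W(M')\to W(M)$ and a homomorphism of Hecke monoids $(W(M'),\star)\to(W(M),\star)$; (b) $\phi$ is a homomorphism of Hecke monoids $(W(M'),\star)\to(W(M),\star)$ and is homogeneous; (c) $\phi$ is a homomorphism of Coxeter groups $W(M')\to W(M)$, satisfies $\phi(s'_i)=w_\circ^{[\phi](i)}$ for all $i\in I'$, and is homogeneous.
   Context: A Coxeter matrix over a finite set $I$ is a symmetric matrix $M=(m_{ij})_{i,j\in I}$ with $m_{ii}=1$ and $m_{ij}\in\mathbb Z_{\ge 2}\cup\{\infty\}$ for $i\ne j$. The Coxeter group $W(M)$ is generated by $s_i$, $i\in I$, subject to $(s_is_j)^{m_{ij}}=1$ whenever $m_{ij}\neq\infty$; $\ell$ is its length function. The Hecke monoid $(W(M),\star)$ is the monoid generated by $s_i$, $i\in I$, subject to $s_i\star s_i=s_i$ and $s_i\star s_j\star\cdots=s_j\star s_i\star\cdots$ ($m_{ij}$ factors on each side) for $i\ne j$ with $m_{ij}<\infty$. Its underlying set is identified with $W(M)$ so that $s_i\star w=s_iw$ if $\ell(s_iw)>\ell(w)$ and $s_i\star w=w$ otherwise (and similarly on the right). Generators for $M'$ are denoted $s'_i$. Homomorphisms of monoids map identity to identity. For $J\subset I$, $W_J(M)$ is the subgroup generated by $s_j$, $j\in J$; if it is finite, $w_\circ^J$ is its longest element. The support $\operatorname{supp}w$ of $w\in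 W(M)$ is the set of $i\in I$ such that $s_i$ occurs in a reduced expression of $w$, and $[\phi](i)=\operatorname{supp}\phi(s'_i)$. (In (c), the condition includes that $W_{[\phi](i)}(M)$ is finite.) A map $f:W(M')\to W(M)$ is homogeneous if, with $\ell_f(w):=\ell(f(w))$, one has $\ell_f(ww')=\ell_f(w)+\ell_f(w')$ for all $w,w'\in W(M')$ such that $\ell(ww')=\ell(w)+\ell(w')$. *)

(* Defs.v *)
From HB Require Import structures.
From mathcomp Require Import all_boot.
From mathcomp Require Import boolp classical_sets cardinality.
Set Implicit Arguments. Unset Strict Implicit. Unset Printing Implicit Defensive.

Local Open Scope quotient_scope.
Local Open Scope group_scope.

(* An entry [None] stands for the value oo. *)
Record coxeter_matrix (I : finType) := CoxeterMatrix {
  cox_entry :> I -> I -> option nat;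
  cox_sym : forall i j, cox_entry i j = cox_entry j i;
  cox_diag : forall i, cox_entry i i = Some 1%N;
  cox_offdiag : forall i j m, i != j -> cox_entry i j = Some m -> (2 <= m)%N
}.

(* Monoid presented by the generators I and the relations u = v for R u v. *)
Section PresentedMonoid.
Variables (I : finType) (R : seq I -> seq I -> Prop).

Inductive cong : seq I -> seq I -> Prop :=
| cong_rel a u v b : R u v -> cong (a ++ u ++ b) (a ++ v ++ b)
| cong_refl u : cong u u
| cong_sym u v : cong u v -> cong v u
| cong_trans u v w : cong u v -> cong v w -> cong u w.

Lemma cong_ctx a b u v : cong u v -> cong (a ++ u ++ b) (a ++ v ++ b).
Proof.
elim=> [a' u' v' b' Ruv|u'|u' v' _|u' v' w' _ IH1 _]; last exact: cong_trans.
- have E w' : a ++ (a' ++ w' ++ b') ++ b = (a ++ a') ++ w' ++ (b' ++ b).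
    by rewrite -!catA.
  by rewrite !E; apply: cong_rel.
- exact: cong_refl.
- exact: cong_sym.
Qed.

Lemma cong_cat u u' v v' : cong u u' -> cong v v' -> cong (u ++ v) (u' ++ v').
Proof.
move=> /(cong_ctx [::] v) /= Hu /(cong_ctx u' [::]); rewrite !cats0.
exact: cong_trans.
Qed.

Definition congb : rel (seq I) := fun u v => `[< cong u v >].

Lemma congb_refl : reflexive congb.
Proof. by move=> u; apply/asboolP; apply: cong_refl. Qed.

Lemma congb_sym : symmetric congb.
Proof. by move=> u v; apply/asboolP/asboolP; apply: cong_sym. Qed.

Lemma congb_trans : transitive congb.
Proof. by move=> v u w /asboolP uv /asboolP vw; apply/asboolP/(cong_trans uv). Qed.

Canonical congb_equiv := EquivRel congb congb_refl congb_sym congb_trans.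

Definition presented := {eq_quot congb}.
HB.instance Definition _ := Choice.on presented.
HB.instance Definition _ := EqQuotient.on presented.

Lemma presentedP u v : reflect (cong u v) (\pi_presented u == \pi_presented v).
Proof. by rewrite piE; apply: asboolP. Qed.

Definition pmul (x y : presented) : presented := \pi_presented (repr x ++ repr y).

Lemma pi_pmul u v : pmul (\pi u) (\pi v) = \pi_presented (u ++ v).
Proof.
by apply/eqP/presentedP; apply: cong_cat; apply/presentedP; rewrite reprK.
Qed.

Lemma pmulA : associative pmul.
Proof.
move=> x y z; rewrite -[x]reprK -[y]reprK -[z]reprK.
by rewrite !pi_pmul catA.
Qed.

Lemma pmul1x : left_id (\pi_presented [::]) pmul.
Proof. by move=> x; rewrite -[x]reprK pi_pmul. Qed.

Lemma pmulx1 : right_id (\pi_presented [::]) pmul.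
Proof. by move=> x; rewrite -[x]reprK pi_pmul cats0. Qed.

HB.instance Definition _ := isMonoid.Build presented pmulA pmul1x pmulx1.

End PresentedMonoid.

Section Coxeter.
Variables (I : finType) (M : coxeter_matrix I).

(* The relations (s_i s_j)^m_ij = 1. The case i = j is s_i^2 = 1, which makes
   the generators self-inverse, so that no letters for inverses are needed. *)
Inductive cox_rel : seq I -> seq I -> Prop :=
| CoxRel i j m : M i j = Some m -> cox_rel (flatten (nseq m [:: i; j])) [::].

Definition coxeter := presented cox_rel.
HB.instance Definition _ := Monoid.on coxeter.
HB.instance Definition _ := EqQuotient.on coxeter.

Lemma cong_cox_revr u : cong cox_rel (u ++ rev u) [::].
Proof.
elim: u => [|i u IH]; first exact: cong_refl.
rewrite rev_cons -cats1 cat_cons catA.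
apply: (@cong_trans _ _ _ ([:: i] ++ [::] ++ [:: i])).
  exact: (cong_ctx [:: i] [:: i] IH).
exact: (cong_rel [::] [::] (CoxRel (cox_diag M i))).
Qed.

Definition cox_inv (x : coxeter) : coxeter := \pi_coxeter (rev (repr x)).

Lemma cox_mulV : right_inverse 1 cox_inv (@mul coxeter).
Proof.
move=> x; rewrite -{1}[x]reprK; apply: etrans (pi_pmul _ _ _) _.
exact/eqP/presentedP/cong_cox_revr.
Qed.

Lemma cox_mulVg : left_inverse 1 cox_inv (@mul coxeter).
Proof.
move=> x; rewrite -{2}[x]reprK; apply: etrans (pi_pmul _ _ _) _.
apply/eqP/presentedP; rewrite -{2}[repr x]revK; exact: cong_cox_revr.
Qed.

HB.instance Definition _ := hasInv.Build coxeter cox_inv.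
HB.instance Definition _ := Monoid_isGroup.Build coxeter cox_mulVg cox_mulV.

Definition cox_word (u : seq I) : coxeter := \pi_coxeter u.
Definition cox_gen (i : I) : coxeter := cox_word [:: i].

Lemma cox_len_ex (w : coxeter) :
  exists n, `[< exists2 u, cox_word u = w & size u = n >].
Proof.
by exists (size (repr w)); apply/asboolP; exists (repr w); rewrite // /cox_word reprK.
Qed.

Definition cox_len (w : coxeter) : nat := ex_minn (cox_len_ex w).

Definition reduced_expr (w : coxeter) (u : seq I) : Prop :=
  cox_word u = w /\ size u = cox_len w.

Lemma reduced_expr_ex (w : coxeter) : exists u, `[< reduced_expr w u >].
Proof.
rewrite /reduced_expr /cox_len; case: ex_minnP => n /asboolP[u uw un] _.
by exists u; apply/asboolP.
Qed.

Definition cox_supp (w : coxeter) : {set I} :=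
  [set i | `[< exists2 u, reduced_expr w u & i \in u >]]%SET.

(* The subgroup generated by the s_j, j in J (each s_j is its own inverse). *)
Definition parabolic (J : {set I}) : set coxeter :=
  fun w => exists2 u, all (mem J) u & cox_word u = w.

Definition is_longest (J : {set I}) (w : coxeter) : Prop :=
  parabolic J w /\ forall v, parabolic J v -> v <> w -> (cox_len v < cox_len w)%N.

(* s_i s_j s_i ... with n factors *)
Fixpoint alternating (i j : I) (n : nat) : seq I :=
  if n is n'.+1 then i :: alternating j i n' else [::].

Inductive hecke_rel : seq I -> seq I -> Prop :=
| HeckeIdem i : hecke_rel [:: i; i] [:: i]
| HeckeBraid i j m : i != j -> M i j = Some m ->
    hecke_rel (alternating i j m) (alternating j i m).

Definition hecke := presented hecke_rel.
HB.instance Definition _ := Monoid.on hecke.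
HB.instance Definition _ := EqQuotient.on hecke.

(* The mutually inverse identifications between the Hecke monoid and W(M):
   the class of the word i_1 ... i_k goes to s_{i_1} * ( ... * (s_{i_k} * 1)),
   where s_i * w is s_i w if this is longer than w, and w otherwise; an element
   of W(M) goes to the class of any of its reduced expressions. *)
Definition hecke_act (i : I) (w : coxeter) : coxeter :=
  if (cox_len w < cox_len (cox_gen i * w)%g)%N then cox_gen i * w else w.

Definition of_hecke (h : hecke) : coxeter := foldr hecke_act 1 (repr h).

Definition to_hecke (w : coxeter) : hecke := \pi_hecke (xchoose (reduced_expr_ex w)).

Definition star (v w : coxeter) : coxeter :=
  of_hecke (to_hecke v * to_hecke w).

End Coxeter.

Section Maps.
Variables (I' I : finType) (M' : coxeter_matrix I') (M : coxeter_matrix I).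
Variable phi : coxeter M' -> coxeter M.

Definition coxeter_hom : Prop := monoid_morphism phi.

Definition hecke_hom : Prop :=
  phi 1 = 1 /\ forall v w, phi (star v w) = star (phi v) (phi w).

Definition homogeneous : Prop :=
  forall v w, cox_len (v * w) = (cox_len v + cox_len w)%N ->
  cox_len (phi (v * w)) = (cox_len (phi v) + cox_len (phi w))%N.

Definition supp_image (i : I') : {set I} := cox_supp (phi (cox_gen M' i)).

Definition longest_on_gens : Prop :=
  forall i : I', finite_set (parabolic (M := M) (supp_image i)) /\
    is_longest (supp_image i) (phi (cox_gen M' i)).

End Maps.

(* Main.v *)
(* The Hecke product is the action of reduced words by the operators
   [w |-> s_i * w if this is longer, w otherwise], so lengths add in x y exactly
   when the Hecke product x . y equals x y; hence (a) implies (b).  If x is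
   idempotent for the Hecke product, every letter of its reduced words is a left
   descent of x, which forces x to be the longest element of the parabolic
   subgroup on its support; this gives (b) => (c), and such an x is an
   involution.  Conversely a longest element x absorbs: x . (x y) = x y when
   lengths add in x y, which is the only nontrivial case of (c) => (a). *)
Require Import Defs.
From mathcomp Require Import all_boot.
From mathcomp Require Import boolp classical_sets cardinality zify.
Set Implicit Arguments. Unset Strict Implicit. Unset Printing Implicit Defensive.

(** * Words, length and parity in a Coxeter group *)

Section CoxeterTheory.
Local Open Scope group_scope.
Variables (I : finType) (M : coxeter_matrix I).
Implicit Types (w x y t : coxeter M) (u v p q : seq I) (i j k : I) (J : {set I}).

Local Notation word := (cox_word M).
Local Notation s := (cox_gen M).
Local Notation len := (@cox_len I M).

Lemma cox_word_cat u v : word (u ++ v) = word u * word v.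
Proof. exact/esym/pi_pmul. Qed.

Lemma cox_word_nil : word [::] = 1.
Proof. by []. Qed.

Lemma cox_word_cons i u : word (i :: u) = s i * word u.
Proof. exact: (cox_word_cat [:: i]). Qed.

Lemma cox_word_rcons i u : word (rcons u i) = word u * s i.
Proof. by rewrite -cats1 cox_word_cat. Qed.

Lemma cox_word_congP u v : word u = word v <-> cong (cox_rel M) u v.
Proof.
by split=> [/eqP/presentedP //|uv]; apply/eqP/presentedP.
Qed.

Lemma cox_gen_sq i : s i * s i = 1.
Proof.
rewrite -cox_word_cat; apply/cox_word_congP.
exact: (cong_rel [::] [::] (CoxRel (cox_diag M i))).
Qed.

Lemma cox_genK i w : s i * (s i * w) = w.
Proof. by rewrite mulgA cox_gen_sq mul1g. Qed.

Lemma cox_genV i : (s i)^-1 = s i.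
Proof. exact/mulg1_eq/cox_gen_sq. Qed.

Lemma cox_word_rev u : word (rev u) = (word u)^-1.
Proof.
elim: u => [|i u IH]; first by rewrite invg1.
by rewrite rev_cons cox_word_rcons IH cox_word_cons invgM cox_genV.
Qed.

Lemma cox_len_word u : len (word u) <= size u.
Proof.
by rewrite /cox_len; case: ex_minnP => n _; apply; apply/asboolP; exists u.
Qed.

Lemma reduced_exprP w : exists u, word u = w /\ size u = len w.
Proof. by have [u /asboolP] := reduced_expr_ex w; exists u. Qed.

Lemma cox_lenM x y : len (x * y) <= len x + len y.
Proof.
have [u [<- <-]] := reduced_exprP x; have [v [<- <-]] := reduced_exprP y.
by rewrite -cox_word_cat -size_cat cox_len_word.
Qed.

Lemma cox_len1 : len 1 = 0.
Proof. by apply/eqP; rewrite -leqn0 (cox_len_word [::]). Qed.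

Lemma cox_len0 w : len w = 0 -> w = 1.
Proof. by have [u [<- <-]] := reduced_exprP w => /size0nil->. Qed.

Lemma cox_lenV x : len x^-1 = len x.
Proof.
suff le y : len y^-1 <= len y by apply/eqP; rewrite eqn_leq le -{1}[x]invgK le.
by have [u [<- <-]] := reduced_exprP y; rewrite -cox_word_rev -(size_rev u) cox_len_word.
Qed.

(** All relators have even length; hence multiplying by a generator always changes the length. *)
Lemma cong_cox_odd u v : cong (cox_rel M) u v -> odd (size u) = odd (size v).
Proof.
elim=> // [a u' v' b [i j m _]|u' v' w' _ -> _ //].
rewrite !size_cat !oddD; congr (_ (+) (_ (+) _)).
by elim: m => //= m ->.
Qed.

Lemma odd_cox_len u : odd (len (word u)) = odd (size u).
Proof. by have [v [/cox_word_congP/cong_cox_odd <- <-]] := reduced_exprP (word u). Qed.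

Lemma cox_len_gen_mul i w :
  len (s i * w) = (len w).+1 \/ len w = (len (s i * w)).+1.
Proof.
have gen1 : len (s i) <= 1 := cox_len_word [:: i].
have [u [uw sz]] := reduced_exprP w.
have odd1 : odd (len (s i * w)) = ~~ odd (len w).
  by rewrite -uw -cox_word_cons !odd_cox_len.
have := cox_lenM (s i) w; have := cox_lenM (s i) (s i * w).
by rewrite cox_genK; lia.
Qed.

Lemma cox_len_mul_gen i w :
  len (w * s i) = (len w).+1 \/ len w = (len (w * s i)).+1.
Proof.
have <- : len (s i * w^-1) = len (w * s i) by rewrite -cox_lenV invgM invgK cox_genV.
by rewrite -(cox_lenV w); apply: cox_len_gen_mul.
Qed.

(** * The exchange and deletion properties *)

(* Parity of the number of prefixes [p k] of [u] with [t = p k p^-1]; this is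
   Bourbaki's cocycle [n(w, t)], which makes the exchange property accessible
   without a faithful representation of the group. *)
Fixpoint refl_parity u t : bool :=
  if u is i :: u' then (t == s i) (+) refl_parity u' (t ^ s i) else false.

Lemma refl_parity_cat u v t :
  refl_parity (u ++ v) t = refl_parity u t (+) refl_parity v (t ^ word u).
Proof.
elim: u t => [|i u IH] t /=; first by rewrite cox_word_nil conjg1.
by rewrite IH addbA cox_word_cons conjgM.
Qed.

Lemma cox_word_flatten n i j : word (flatten (nseq n [:: i; j])) = (s i * s j) ^+ n.
Proof.
elim: n => [|n IH] //=.
by rewrite !cox_word_cons IH expgS mulgA.
Qed.

(** The letter at position [l] contributes the palindrome [s i * s j * ... * s i] with [2l+1]
    factors, which is [(s i * s j) ^+ l * s i]. *)
Lemma refl_parity_flatten n i j t :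
  refl_parity (flatten (nseq n [:: i; j])) t =
  \big[addb/false]_(0 <= l < n.*2) (t == (s i * s j) ^+ l * s i).
Proof.
set c := s i * s j.
have cs : c * s i = s i * c^-1 by rewrite invgM !cox_genV mulgA.
have cV l : c ^+ l * s i = s i * c ^- l.
  elim: l => [|l IH]; first by rewrite invg1 mul1g mulg1.
  by rewrite {1}expgS expgSr -mulgA IH invgM !mulgA cs.
elim: n => [|n IH]; first by rewrite big_geq.
rewrite -addn1 nseqD flatten_cat refl_parity_cat IH cox_word_flatten -/c addn1.
rewrite doubleS !big_nat_recr //= addbF -addbA; congr (_ (+) (_ (+) _)).
  rewrite (can2_eq (conjgK _) (conjgKV _)) /conjg invgK.
  by rewrite -cV mulgA -expgnDr addnn.
rewrite -conjgM (can2_eq (conjgK _) (conjgKV _)) /conjg invgK invgM cox_genV.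
by rewrite -!mulgA -cV (mulgA (s i)) (mulgA _ (c ^+ n)) -expgS mulgA -expgnDr addnS addnn.
Qed.

Lemma cong_refl_parity u v : cong (cox_rel M) u v -> refl_parity u =1 refl_parity v.
Proof.
move=> uv t; elim: uv t => {u v} // [a u v b [i j m Mij] t|u v w _ IH1 _ IH2 t].
- have u1 : word (flatten (nseq m [:: i; j])) = 1.
    apply/cox_word_congP; have := cong_rel [::] [::] (CoxRel Mij).
    by rewrite /= cats0.
  rewrite !refl_parity_cat u1 cox_word_nil conjg1; congr (_ (+) (_ (+) _)).
  (* As [(s i * s j) ^+ m = 1], the terms [l] and [l + m] agree, so the two halves of the sum cancel
     modulo 2. *)
  rewrite refl_parity_flatten -addnn (@big_cat_nat _ _ _ m) ?leq_addr //=.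
  rewrite -{2}[m]add0n big_addn addnK.
  under [X in _ (+) X]eq_bigr do rewrite expgnDr -[_ ^+ m]cox_word_flatten u1 mulg1.
  by rewrite addbb.
- by rewrite IH1.
Qed.

Lemma refl_parity_delete u t : refl_parity u t ->
  exists p k q, u = p ++ k :: q /\ t * word u = word (p ++ q).
Proof.
elim: u t => [//|k u IH] t /=; case: eqP => [-> _|_ /IH[p [k' [q [-> e]]]]].
  by exists [::], k, u; rewrite cox_word_cons cox_genK.
exists (k :: p), k', q; split=> //=.
by rewrite !cox_word_cons -e conjgE cox_genV !mulgA cox_gen_sq mul1g.
Qed.

(** Replace [u] by [i :: v] with [v] reduced: the head contributes once, and a contribution from [v]
    would let a letter of [v] be deleted, giving too short a word for [word u]. *)
Lemma refl_parity_descent i u : len (s i * word u) < len (word u) -> refl_parity u (s i).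
Proof.
move=> lt; have [v [vE sz]] := reduced_exprP (s i * word u).
have /cox_word_congP/cong_refl_parity-> : word u = word (i :: v).
  by rewrite cox_word_cons vE cox_genK.
rewrite /= eqxx conjgE cox_gen_sq mulg1 cox_genV /=.
apply/negP => /refl_parity_delete[p [k [q [vpq]]]].
rewrite vE cox_genK => uE; move: lt; rewrite -sz vpq uE.
by have := cox_len_word (p ++ q); rewrite !size_cat /=; lia.
Qed.

Lemma cox_exchange i u : len (s i * word u) < len (word u) ->
  exists p k q, u = p ++ k :: q /\ s i * word u = word (p ++ q).
Proof. by move=> /refl_parity_descent/refl_parity_delete. Qed.

Lemma reduced_subseq u :
  exists v, [/\ subseq v u, word v = word u & size v = len (word u)].
Proof.
elim: u => [|i u [v [sub vE sz]]]; first by exists [::]; rewrite cox_len1.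
rewrite cox_word_cons; case: (cox_len_gen_mul i (word u)) => e.
  by exists (i :: v); rewrite /= eqxx cox_word_cons vE e sz.
have [] := @cox_exchange i v; first by rewrite vE e.
move=> p [k [q [vpq E]]]; exists (p ++ q); split.
- apply: subseq_trans (subseq_cons u i); apply: subseq_trans sub.
  by rewrite vpq cat_subseq ?subseq_cons.
- by rewrite -E vE.
- by move: sz; rewrite vpq e !size_cat /=; lia.
Qed.

(** * The Hecke operators on the Coxeter group *)

Lemma hecke_actE i w :
  hecke_act i w = if len w < len (s i * w) then s i * w else w.
Proof. by []. Qed.

Definition right_act j w := if len w < len (w * s j) then w * s j else w.

(** The critical case has [s i * w] and [w * s j] longer than [w], but [s i * w * s j] shorter than
    [w * s j]. Exchange then deletes either the final [j], so that [s i * w = w * s j], or a letter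
    of [w], which would make [s i * w] shorter than [w]. *)
Lemma hecke_act_right i j w :
  hecke_act i (right_act j w) = right_act j (hecke_act i w).
Proof.
rewrite !hecke_actE /right_act.
have A : s i * w * s j = s i * (w * s j) by rewrite mulgA.
have L := cox_len_gen_mul i w; have R := cox_len_mul_gen j w.
have LR := cox_len_gen_mul i (w * s j); have RL := cox_len_mul_gen j (s i * w).
rewrite A in RL.
case: (ltnP (len w) (len (w * s j))) => gR; case: (ltnP (len w) (len (s i * w))) => gL.
- rewrite A; case: (ltnP (len (w * s j))) => g.
    by rewrite ifT //; lia.
  rewrite ifF; last by lia.
  have [u [uE sz]] := reduced_exprP w.
  have [] := @cox_exchange i (rcons u j); first by rewrite cox_word_rcons uE; lia.
  move=> p [k [q []]]; rewrite cox_word_rcons uE.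
  case/lastP: q => [|q l]; rewrite ?cats1.
    by move=> /rcons_inj[<- _]; rewrite cats0 uE => E; rewrite -{2}E cox_genK.
  rewrite -rcons_cons -!rcons_cat => /rcons_inj[upq <-].
  rewrite cox_word_rcons -A => /mulIg E.
  have := cox_len_word (p ++ q); rewrite -E.
  by move: sz gL; rewrite upq !size_cat /=; lia.
- by rewrite gR ifF //; lia.
- by rewrite A ifF //; lia.
- by rewrite ifF //; lia.
Qed.

Local Notation act u w := (foldr (@hecke_act I M) w u).

Lemma hecke_act_cases i w :
  hecke_act i w = s i * w /\ len (s i * w) = (len w).+1 \/
  hecke_act i w = w /\ len w = (len (s i * w)).+1.
Proof.
rewrite hecke_actE; have [e|e] := cox_len_gen_mul i w.
- by left; rewrite ifT //; lia.
- by right; rewrite ifF //; lia.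
Qed.

Lemma hecke_act_fix i w : hecke_act i w = w <-> len (s i * w) < len w.
Proof.
have [[-> e]|[-> e]] := hecke_act_cases i w; last by split=> // _; rewrite [ltnRHS]e.
by split=> [e'|]; [move: e; rewrite e'|]; lia.
Qed.

Lemma cox_len_gen i : len (s i) = 1%N.
Proof. by have := cox_len_gen_mul i 1; rewrite mulg1 cox_len1 => -[]. Qed.

Lemma hecke_act1 i : hecke_act i 1 = s i.
Proof. by rewrite hecke_actE mulg1 cox_len1 cox_len_gen. Qed.

Lemma hecke_act_idem i w : hecke_act i (hecke_act i w) = hecke_act i w.
Proof.
apply/hecke_act_fix.
by have [[-> e]|[-> e]] := hecke_act_cases i w; rewrite ?cox_genK e.
Qed.

Lemma act_reduced u w : len (word u * w) = size u + len w -> act u w = word u * w.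
Proof.
elim: u => [|i u IH]; first by rewrite cox_word_nil mul1g.
have A : word (i :: u) * w = s i * (word u * w) by rewrite cox_word_cons mulgA.
rewrite A /= => e; have L := cox_len_gen_mul i (word u * w).
have := cox_lenM (word u) w; have := cox_len_word u => le1 le2.
rewrite IH; last by lia.
by rewrite hecke_actE ifT //; lia.
Qed.

Lemma act_reduced1 u : size u = len (word u) -> act u 1 = word u.
Proof. by move=> e; rewrite act_reduced mulg1 // cox_len1 addn0. Qed.

(** [v] keeps exactly the letters that raise the length when they act. *)
Lemma act_subseq u w :
  exists v, [/\ subseq v u, act u w = word v * w & len (act u w) = size v + len w].
Proof.
elim: u => [|i u [v [sub vE sz]]] /=; first by exists [::]; rewrite mul1g.
rewrite {1 2}hecke_actE; case: ltnP => lt; last first.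
  by exists v; split=> //; apply: subseq_trans (subseq_cons u i).
exists (i :: v); rewrite /= eqxx cox_word_cons -mulgA -vE; split=> //.
by rewrite addSn -sz; have := cox_len_gen_mul i (act u w); lia.
Qed.

Lemma act_right u j w : act u (right_act j w) = right_act j (act u w).
Proof. by elim: u => //= i u ->; rewrite hecke_act_right. Qed.

(* The operators [hecke_act i] commute with the [right_act j], and the latter
   reach every element from 1; hence an operator is determined by its value at 1. *)
Lemma act_eq1 u v : act u 1 = act v 1 -> forall w, act u w = act v w.
Proof.
move=> e w; have [p [<-]] := reduced_exprP w.
elim/last_ind: p => [//|p j IH]; rewrite cox_word_rcons size_rcons => sz.
have L := cox_len_mul_gen j (word p); have le := cox_len_word p.
have -> : word p * s j = right_act j (word p) by rewrite /right_act ifT //; lia.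
by rewrite !act_right IH //; lia.
Qed.

(** * Longest elements of parabolic subgroups *)

Lemma parabolic_reduced J w : parabolic J w ->
  exists u, [/\ all (mem J) u, word u = w & size u = len w].
Proof.
move=> [u uJ <-]; have [v [sub vE sz]] := reduced_subseq u.
by exists v; split=> //; apply/allP=> k /(mem_subseq sub); apply: (allP uJ).
Qed.

(** By [hecke_act_fix], this says that [J] consists of left descents of [x]. *)
Definition absorbs J x := forall j, j \in J -> hecke_act j x = x.

Lemma absorbs_prefix J x : absorbs J x ->
  forall u, all (mem J) u -> size u = len (word u) ->
  exists y, x = word u * y /\ len x = size u + len y.
Proof.
move=> fixx; elim=> [|i u IH] /= => [_ _|/andP[iJ uJ] sz].
  by exists x; rewrite mul1g.
have := cox_len_word u; have := cox_len_gen_mul i (word u).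
rewrite -cox_word_cons => L1 L2.
have [//||y [xE xl]] := IH; first by lia.
have [b [bE bl]] := reduced_exprP y.
have ltx := (hecke_act_fix i x).1 (fixx i iJ).
have ubE : word (u ++ b) = x by rewrite cox_word_cat bE.
have [] := @cox_exchange i (u ++ b); first by rewrite ubE.
rewrite ubE => p [k [q [E sxE]]].
have bq : b = drop (size u) (p ++ k :: q) by rewrite -E drop_size_cat.
have uq : u = take (size u) (p ++ k :: q) by rewrite -E take_size_cat.
(* Locate the letter [k] deleted by exchange. If it lies in [b], whether later or at its head, then
   [i :: u] splits off from [x]. If it lies in [u], cancelling [y] shows that [i :: u] is not
   reduced, a contradiction. *)
move: bq uq; rewrite take_cat drop_cat; case: ltnP => lt.
  move=> bE' _; exists (word (drop (size u) p ++ q)).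
  have pu : p = u ++ drop (size u) p.
    rewrite -{1}(cat_take_drop (size u) p); congr (_ ++ _).
    by move/(congr1 (take (size u))): E; rewrite take_size_cat // takel_cat // ltnW.
  have xE' : x = word (i :: u) * word (drop (size u) p ++ q).
    by rewrite cox_word_cons -mulgA -(cox_word_cat u) catA -pu -sxE cox_genK.
  split=> //; move: bl; rewrite bE' size_cat /= => bl.
  have := cox_len_word (drop (size u) p ++ q); rewrite size_cat.
  have := cox_lenM (word (i :: u)) (word (drop (size u) p ++ q)); rewrite -xE'.
  by lia.
case d : (size u - size p) => [|d'] /=.
  rewrite cats0 => bE' uE'; exists (word q).
  have xE' : x = word (i :: u) * word q.
    by rewrite cox_word_cons -mulgA -(cox_word_cat u) uE' -sxE cox_genK.
  split=> //; move: bl; rewrite bE' /= => bl.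
  have := cox_len_word q.
  have := cox_lenM (word (i :: u)) (word q); rewrite -xE'.
  by lia.
move=> bE' uE'; suff e : word (i :: u) = word (p ++ take d' q).
  have := cox_len_word (p ++ take d' q); rewrite -e -sz size_cat.
  by move/(congr1 size): uE'; rewrite size_cat /=; lia.
apply: (mulIg y); rewrite cox_word_cons -mulgA -xE sxE -bE bE' -cox_word_cat.
by rewrite -catA cat_take_drop.
Qed.

Lemma absorbs_longest J x : parabolic J x ->
  absorbs J x -> is_longest J x.
Proof.
move=> xJ fixx; split=> // v /parabolic_reduced[u [uJ <- sz]] ne.
have [y [xE ->]] := absorbs_prefix fixx uJ sz.
case: (posnP (len y)) => [/cox_len0 y1|]; last by lia.
by case: ne; rewrite xE y1 mulg1.
Qed.

Lemma longest_absorbs J x : is_longest J x -> absorbs J x.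
Proof.
move=> [[u uJ uE] max] j jJ; apply/hecke_act_fix.
have jx : parabolic J (s j * x).
  by exists (j :: u); rewrite /= ?uJ ?andbT // cox_word_cons uE.
apply: max => // e; have := cox_len_gen_mul j x; rewrite e; lia.
Qed.

Lemma longest_unique J x y : is_longest J x -> is_longest J y -> x = y.
Proof.
move=> [xJ xmax] [yJ ymax]; apply: contrapT => ne.
have := xmax _ yJ (fun e => ne (esym e)); have := ymax _ xJ ne; lia.
Qed.

Lemma longest_sq J x : is_longest J x -> x * x = 1.
Proof.
move=> [[u uJ uE] max]; suff e : x^-1 = x by rewrite -{1}e mulVg.
apply: contrapT => ne; have := max x^-1; rewrite cox_lenV ltnn.
move=> absurd; suff: false by []; apply: absurd => //.
by exists (rev u); rewrite ?all_rev // cox_word_rev uE.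
Qed.

(** Reduced words over [J] have at most [len x] letters, and there are finitely many such words. *)
Lemma parabolic_finite J x : absorbs J x ->
  finite_set (parabolic (M := M) J).
Proof.
move=> fixx.
apply: (@sub_finite_set _ _ [set word (val u) | u in [set: (len x).-bseq I]]%classic).
  move=> v /parabolic_reduced[u [uJ uE sz]].
  rewrite -uE in sz; have [y [_ e]] := absorbs_prefix fixx uJ sz.
  have le : size u <= len x by rewrite e leq_addr.
  by exists (Bseq le).
exact/finite_image/finite_finset.
Qed.

(** * Braid relations for the Hecke operators *)

Lemma size_alternating i j n : size (alternating i j n) = n.
Proof. by elim: n i j => //= n IH i j; rewrite IH. Qed.

(** When prepending [i] first fails to lengthen a reduced alternating word, [i] is a left descent,
    and so is [j], the first letter of that word; afterwards nothing changes. *)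
Lemma alternating_dichotomy i j n :
  absorbs [set i; j]%SET (act (alternating i j n) 1)
  \/ len (word (alternating i j n)) = n.
Proof.
elim: n i j => [|n IH] i j; first by right; rewrite cox_len1.
have [fixd|sz] := IH j i.
  left; rewrite /= fixd; last by rewrite !inE eqxx orbT.
  by move=> k; rewrite !inE orbC => kij; apply: fixd; rewrite !inE.
have aE : act (alternating j i n) 1 = word (alternating j i n).
  by apply: act_reduced1; rewrite size_alternating sz.
have [e|e] := cox_len_gen_mul i (word (alternating j i n)).
  by right; rewrite /= cox_word_cons e sz.
left=> k; have fixi : hecke_act i (word (alternating j i n)) = word (alternating j i n).
  by apply/hecke_act_fix; rewrite [ltnRHS]e.
rewrite /= aE fixi !inE => /orP[] /eqP-> //; rewrite -aE.
case: n {IH} sz aE e {fixi} => [|n] sz aE e /=; first by rewrite sz in e.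
exact: hecke_act_idem.
Qed.

Lemma all_alternating i j n : all (mem [set i; j]%SET) (alternating i j n).
Proof.
elim: n i j => //= n IH i j; rewrite !inE eqxx /=.
by apply/allP=> k /(allP (IH j i)); rewrite !inE orbC.
Qed.

(** Turns the relation [(s i * s j) ^+ m = 1] into a braid relation without separating even and odd
    [m]. *)
Lemma word_alternating_div i j n :
  word (alternating i j n) * (word (alternating j i n))^-1 = (s i * s j) ^+ n.
Proof.
elim: n i j => [|n IH] i j; first by rewrite mulgV.
rewrite /= !cox_word_cons invgM cox_genV -mulgA (mulgA (word (alternating j i n))) IH.
elim: n {IH} => [|n IH]; first by rewrite mul1g.
by rewrite [in RHS]expgS -IH expgS !mulgA.
Qed.

Lemma alternating_braid i j m : M i j = Some m ->
  word (alternating i j m) = word (alternating j i m).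
Proof.
move=> Mij; apply: divg1_eq; rewrite word_alternating_div -cox_word_flatten.
by apply/cox_word_congP; have := cong_rel [::] [::] (CoxRel Mij); rewrite /= cats0.
Qed.

Lemma act_alternating_longest i j n :
  absorbs [set i; j]%SET (act (alternating i j n) 1) ->
  is_longest [set i; j]%SET (act (alternating i j n) 1).
Proof.
apply: absorbs_longest; have [v [sub -> _]] := act_subseq (alternating i j n) 1.
exists v; rewrite ?mulg1 //.
by apply/allP=> k /(mem_subseq sub); apply/allP/all_alternating.
Qed.

(* Proved without knowing that [s i * s j] has order exactly [m]: if the
   alternating words of length [m] are not reduced, both sides are the longest
   element of the dihedral subgroup. *)
Lemma act_braid i j m : M i j = Some m ->
  act (alternating i j m) 1 = act (alternating j i m) 1.
Proof.
move=> Mij; have e := alternating_braid Mij.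
have red : len (word (alternating i j m)) = m ->
    act (alternating i j m) 1 = act (alternating j i m) 1.
  by move=> sz; rewrite !act_reduced1 ?size_alternating -?e ?sz.
have [/act_alternating_longest li|/red//] := alternating_dichotomy i j m.
have [/act_alternating_longest lj|] := alternating_dichotomy j i m; last by rewrite -e.
by apply: longest_unique li _; rewrite finset.setUC.
Qed.

Lemma act_cong u v : cong (hecke_rel M) u v -> forall w, act u w = act v w.
Proof.
elim=> {u v} // [a u v b uv|u v w _ IH1 _ IH2] x; last by rewrite IH1.
(* The context is stripped and the remaining equality of operators is tested at 1 only. *)
rewrite !foldr_cat; congr foldr; move: (act b x); apply: act_eq1.
case: uv => [i|i j m _ Mij]; last exact: act_braid.
by rewrite /= hecke_act_idem.
Qed.

(** * The Hecke product in terms of operators *)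

(** Frees [star] from its chosen reduced words: two reduced words of one element act alike at 1,
    hence everywhere. *)
Lemma star_act u w : size u = len (word u) -> star (word u) w = act u w.
Proof.
have red y (h := xchoose (reduced_expr_ex y)) : word h = y /\ size h = len y.
  by apply/asboolP/(xchooseP (reduced_expr_ex y)).
have repE a : of_hecke (\pi_(hecke M)%qT a) = act a 1.
  by apply: act_cong; apply/presentedP; rewrite reprK.
move=> sz; rewrite /star /to_hecke.
set a := xchoose _; set b := xchoose _.
have [aE al] : word a = word u /\ size a = len (word u) by apply: red.
have [bE bl] : word b = w /\ size b = len w by apply: red.
rewrite (_ : _ * _ = \pi_(hecke M)%qT (a ++ b)); last exact: pi_pmul.
rewrite repE foldr_cat (act_reduced1 (u := b)) ?bE //.
by apply: act_eq1; rewrite !act_reduced1 ?aE.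
Qed.

Lemma star_mul x y : len (x * y) = len x + len y <-> star x y = x * y.
Proof.
have [u [<- sz]] := reduced_exprP x; rewrite star_act //; split=> [e|e].
  by rewrite act_reduced // sz.
have [v [sub vE vl]] := act_subseq u y.
have uv : word v = word u by apply: (mulIg y); rewrite -vE.
have := cox_len_word v; have := cox_lenM (word u) y; rewrite uv -e vl; lia.
Qed.

(** Full length means that no letter of a reduced word of [x] was dropped. *)
Lemma star_mul_len x y : len (star x y) = len x + len y -> star x y = x * y.
Proof.
have [u [<- sz]] := reduced_exprP x; rewrite star_act //.
have [v [sub -> ->]] := act_subseq u y => e.
have /eqP-> // : v == u by rewrite -(size_subseq_leqif sub) sz -(eqn_add2r (len y)) e.
Qed.

Lemma star_gen i w : star (s i) w = hecke_act i w.
Proof.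
by rewrite -[s i]/(word [:: i]) star_act // [RHS]cox_len_gen.
Qed.

Lemma act_fix u w : all (fun i => len (s i * w) < len w) u -> act u w = w.
Proof. by elim: u => //= i u IH /andP[/hecke_act_fix iw /IH->]. Qed.

Lemma idempotent_absorbs x : star x x = x -> absorbs (cox_supp x) x.
Proof.
move=> xx i; rewrite inE => /asboolP[u [uE sz]].
rewrite -{1}uE star_act ?uE // in xx.
(* Operators never shorten, so if a word returns [x] to itself, no letter may lengthen and each one
   fixes [x]. *)
suff H v : act v x = x -> i \in v -> hecke_act i x = x by apply: H.
elim: v => //= k v IH e.
have le : len x <= len (act v x) by have [p [_ _ ->]] := act_subseq v x; rewrite leq_addl.
have vx : act v x = x.
  move: e; rewrite hecke_actE; case: ltnP => // lt e; move: lt; rewrite e.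
  by rewrite ltnNge le.
by rewrite vx in e; rewrite inE => /orP[/eqP->|/(IH vx)].
Qed.

Lemma parabolic_supp x : parabolic (cox_supp x) x.
Proof.
have [u [uE sz]] := reduced_exprP x; exists u => //.
by apply/allP=> i iu; rewrite /= inE; apply/asboolP; exists u.
Qed.

Lemma star_longestK J x y : is_longest J x -> len (x * y) = len x + len y ->
  star x (x * y) = x * y.
Proof.
move=> xJ e; have [u [uJ uE sz]] := parabolic_reduced xJ.1.
rewrite -{1}uE star_act ?uE //; apply: act_fix; apply/allP=> i /(allP uJ) iJ.
have /hecke_act_fix lt := longest_absorbs xJ iJ.
have A : s i * (x * y) = s i * x * y by rewrite mulgA.
by rewrite A e; have := cox_lenM (s i * x) y; lia.
Qed.

End CoxeterTheory.

(** * The implications between the three conditions *)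

Section Morphisms.
Local Open Scope group_scope.
Variables (I' I : finType) (M' : coxeter_matrix I') (M : coxeter_matrix I).
Variable phi : coxeter M' -> coxeter M.
Implicit Types (v w : coxeter M') (i : I').

Local Notation s := (cox_gen M').

Lemma coxeter_hecke_homogeneous : coxeter_hom phi -> hecke_hom phi -> homogeneous phi.
Proof.
move=> [_ phiM] [_ phiS] v w /star_mul e.
by rewrite phiM; apply/star_mul; rewrite -phiS e phiM.
Qed.

Lemma hecke_homogeneous_longest : hecke_hom phi -> longest_on_gens phi.
Proof.
move=> [_ phiS] i.
have desc : absorbs (supp_image phi i) (phi (s i)).
  apply: idempotent_absorbs.
  by rewrite -phiS star_gen -(hecke_act1 M' i) hecke_act_idem.
split; first exact: parabolic_finite desc.
by apply: absorbs_longest desc; apply: parabolic_supp.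
Qed.

Lemma gen_mul_coxeter_hom : phi 1 = 1 ->
  (forall i w, phi (s i * w) = phi (s i) * phi w) -> coxeter_hom phi.
Proof.
move=> phi1 phis; split=> // v w; have [u [<- _]] := reduced_exprP v.
elim: u => [|i u IH]; first by rewrite cox_word_nil phi1 !mul1g.
by rewrite cox_word_cons -mulgA !phis IH mulgA.
Qed.

Lemma homogeneous_gen_mul i w : homogeneous phi ->
  cox_len (s i * w) = (cox_len w).+1 ->
  cox_len (phi (s i * w)) = (cox_len (phi (s i)) + cox_len (phi w))%N.
Proof.
by move=> homog e; apply: homog; rewrite e cox_len_gen.
Qed.

(** For ascents, homogeneity gives the Hecke product its full length, so it is the group product. A
    descent from [w] is an ascent from [s i * w], read backwards because [phi (s i)] is an
    involution. *)
Lemma hecke_homogeneous_coxeter : hecke_hom phi -> homogeneous phi -> coxeter_hom phi.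
Proof.
move=> heckephi homog; have [phi1 phiS] := heckephi.
have up i w : cox_len (s i * w) = (cox_len w).+1 -> phi (s i * w) = phi (s i) * phi w.
  move=> e; have starE : star (s i) w = s i * w.
    by rewrite star_gen hecke_actE ifT // [ltnRHS]e.
  rewrite -starE phiS; apply: star_mul_len.
  by rewrite -phiS starE; apply: homogeneous_gen_mul.
apply: gen_mul_coxeter_hom => // i w.
have [/up//|e] := cox_len_gen_mul i w.
have [_ /longest_sq sq] := hecke_homogeneous_longest heckephi i.
rewrite -{2}(cox_genK i w) (up i (s i * w)); last by rewrite cox_genK.
by rewrite mulgA sq mul1g.
Qed.

Lemma longest_homogeneous_hecke :
  coxeter_hom phi -> longest_on_gens phi -> homogeneous phi -> hecke_hom phi.
Proof.
move=> [phi1 phiM] long homog; split=> // v w.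
have gen i x : phi (hecke_act i x) = star (phi (s i)) (phi x).
  have [[-> e]|[-> e]] := hecke_act_cases i x.
    apply/esym; rewrite phiM; apply/star_mul; rewrite -phiM.
    exact: homogeneous_gen_mul.
  have e' : cox_len (s i * (s i * x)) = (cox_len (s i * x)).+1 by rewrite cox_genK.
  have := homogeneous_gen_mul homog e'; rewrite phiM => el.
  have -> : phi x = phi (s i) * phi (s i * x) by rewrite -phiM cox_genK.
  by rewrite (star_longestK (long i).2).
have [u [<- sz]] := reduced_exprP v; rewrite star_act //.
elim: u sz => [|i u IH] sz /=.
  by rewrite phi1 -[1](cox_word_nil M) star_act ?cox_len1.
have le := cox_len_word M' u; have L := cox_len_gen_mul i (cox_word M' u).
rewrite -cox_word_cons -sz in L; have szu : size u = cox_len (cox_word M' u).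
  by move: L => /=; lia.
(* By homogeneity the concatenation [p ++ q] of reduced words of the two images is reduced, so its
   operator is that of [p] after that of [q]; this is the instance of associativity of [star] needed
   here. *)
rewrite gen IH //; have [p [pE pl]] := reduced_exprP (phi (s i)).
have [q [qE ql]] := reduced_exprP (phi (cox_word M' u)).
have el : cox_len (s i * cox_word M' u) = (cox_len (cox_word M' u)).+1.
  by rewrite -cox_word_cons -sz -szu.
have pqE : phi (cox_word M' (i :: u)) = cox_word M (p ++ q).
  by rewrite cox_word_cons phiM cox_word_cat pE qE.
have pql := homogeneous_gen_mul homog el; rewrite -cox_word_cons pqE in pql.
rewrite pqE star_act ?size_cat ?pql ?pl ?ql // foldr_cat.
by rewrite -pE -qE !star_act ?pE ?qE.
Qed.

End Morphisms.

Theorem proposition3p20 (I' I : finType)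
    (M' : coxeter_matrix I') (M : coxeter_matrix I)
    (phi : coxeter M' -> coxeter M) :
  [<-> coxeter_hom phi /\ hecke_hom phi;
       hecke_hom phi /\ homogeneous phi;
       [/\ coxeter_hom phi, longest_on_gens phi & homogeneous phi]].
Proof.
tfae.
- by move=> [hc hh]; split=> //; apply: coxeter_hecke_homogeneous.
- move=> [hh hom]; split=> //; first exact: hecke_homogeneous_coxeter.
  exact: hecke_homogeneous_longest.
- by move=> [hc hl hom]; split=> //; apply: longest_homogeneous_hecke.
Qed.
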